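(* Let $S$ be a symmetric conference matrix of order $4n+2\geq 6$. Then (i) $\mathfrak H_S(4n+2,4,5)$ is a $3$-$(4n+2,4,3n)$ design; (ii) $\mathfrak H_S(4n+2,4,-3)$ is a $3$-$(4n+2,4,n-1)$ design.
   Context: A symmetric conference matrix of order $m$ is an $m\times m$ symmetric matrix $S$ with zero diagonal and all off-diagonal entries in $\{-1,1\}$ such that $SS^{\top}=(m-1)I$. For a $v\times v$ matrix $A$, $\mathfrak H_A(v,k,a)$ is the $k$-uniform hypergraph with vertex set $[v]=\{1,\dots,v\}$ whose hyperedges are the $k$-subsets $\alpha\subset[v]$ with $\det(A[\alpha])=a$, where $A[\alpha]$ is the principal submatrix of $A$ indexed by $\alpha$. For positive integers $t,v,k,\lambda$, a $t$-$(v,k,\lambda)$ design is a $k$-uniform hypergraph on a $v$-element vertex set with the property that any set of $t$ vertices appear together in precisely $\lambda$ hyperedges.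
   Formalization: A design is allowed to have λ = 0 (no set of t vertices lies in a hyperedge), since for order 6 (n = 1) part (ii) has λ = n − 1 = 0, whereas the definition of a design asks for positive λ. *)

(* Defs.v *)
From mathcomp Require Import all_boot all_order all_algebra.

Set Implicit Arguments.
Unset Strict Implicit.
Unset Printing Implicit Defensive.

Import GRing.Theory Num.Theory.
Local Open Scope ring_scope.

Definition symmetric_conference_matrix (R : numDomainType) (m : nat)
    (S : 'M[R]_m) : Prop :=
  [/\ S^T = S,
      forall i, S i i = 0,
      forall i j, i != j -> S i j = -1 \/ S i j = 1
    & S *m S^T = (m%:R - 1)%:M].

(* A[alpha]: enum_val lists the elements of alpha in increasing order. *)
Definition principal_submx (R : Type) (v : nat) (A : 'M[R]_v)
    (alpha : {set 'I_v}) : 'M[R]_#|alpha| :=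
  mxsub (@enum_val _ (mem alpha)) (@enum_val _ (mem alpha)) A.

(* A hypergraph on the vertex set T is given by its set of hyperedges. *)
Definition det_hypergraph (R : numDomainType) (v : nat) (A : 'M[R]_v)
    (k : nat) (a : R) : {set {set 'I_v}} :=
  [set alpha : {set 'I_v} |
    (#|alpha| == k) && (\det (principal_submx A alpha) == a)].

Definition uniform_hypergraph (T : finType) (k : nat)
    (E : {set {set T}}) : Prop :=
  forall e, e \in E -> #|e| = k.

(* lambda = 0 (no t-set lies in an edge) is allowed: a symmetric conference
   matrix of order 6 has no order-4 principal minor equal to -3. *)
Definition is_design (T : finType) (t v k lambda : nat)
    (E : {set {set T}}) : Prop :=
  [/\ #|T| = v,
      uniform_hypergraph k E
    & forall B : {set T}, #|B| = t ->
        #|[set e in E | B \subset e]| = lambda].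

(* Main.v *)
(** Every order-4 principal minor of [S] is [3 - 2 q] with [q = 3] or [q = -1],
    so it is [-3] or [5].  Fix a triple {i, j, k}: orthogonality of the rows of
    [S] gives the sum of [q] over the [4 n - 1] fourth points, hence the sum of
    the minors, [3 (4 n + 2) - 3].  With the number of fourth points this
    determines how often each of the two values is taken. *)
Require Import Defs.
From mathcomp Require Import all_boot all_order all_algebra all_fingroup ring zify.
Set Implicit Arguments.
Unset Strict Implicit.
Unset Printing Implicit Defensive.
Import GRing.Theory Num.Theory.
Local Open Scope ring_scope.

(** With a zero diagonal only derangements contribute: the three double transpositions give the
    squares, and the six 4-cycles, which are odd, give each cross product twice (a cycle and its
    inverse). *)
Lemma det_symmetric_mx44 (R : comPzRingType) (f : nat -> nat -> R) :
    (forall a b, f a b = f b a) -> (forall a, f a a = 0) ->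
  let x := f 0 1 * f 2 3 in
  let y := f 0 2 * f 1 3 in
  let z := f 0 3 * f 1 2 in
  \det (\matrix_(a < 4, b < 4) f a b) =
    x ^+ 2 + y ^+ 2 + z ^+ 2 - (x * y + x * z + y * z) *+ 2.
Proof.
move=> fC f0 x y z; rewrite {}/x {}/y {}/z.
do 3![rewrite !(expand_det_row _ 0) !big_ord_recl !big_ord0 /cofactor].
rewrite !det_mx11 !mxE /= /bump /= !f0.
rewrite (fC 1 0) (fC 2 0) (fC 3 0) (fC 2 1) (fC 3 1) (fC 3 2).
by ring.
Qed.

(** Rows and columns are permuted alike, so the sign of the permutation enters squared. *)
Lemma det_mxsub_perm (R : comPzRingType) v n (A : 'M[R]_v)
    (s t : n.-tuple 'I_v) :
  perm_eq s t ->
  \det (mxsub (tnth s) (tnth s) A) = \det (mxsub (tnth t) (tnth t) A).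
Proof.
case/tuple_permP=> p /val_inj ->.
have -> : mxsub (tnth [tuple tnth t (p i) | i < n])
                (tnth [tuple tnth t (p i) | i < n]) A =
          row_perm p (col_perm p (mxsub (tnth t) (tnth t) A)).
  by apply/matrixP=> i j; rewrite !mxE !tnth_mktuple.
rewrite row_permE col_permE !det_mulmx !det_perm odd_permV.
by rewrite mulrC -mulrA -expr2 sqrr_sign mulr1.
Qed.

Lemma det_principal_submx (R : comPzRingType) v n (A : 'M[R]_v)
    (alpha : {set 'I_v}) (t : n.-tuple 'I_v) :
    uniq t -> alpha =i t ->
  \det (principal_submx A alpha) = \det (mxsub (tnth t) (tnth t) A).
Proof.
move=> Ut At.
have n_alpha : n = #|alpha|.
  by rewrite (eq_card At) (card_uniqP Ut) size_tuple.
subst n; rewrite -(det_mxsub_perm A (s := enum_tuple (mem alpha))).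
  congr (\det _); apply/matrixP=> i j.
  by rewrite !mxE !(tnth_nth (enum_val i)) /enum_val;
    congr (A _ _); apply: set_nth_default; rewrite -cardE.
apply: uniq_perm; rewrite ?enum_uniq // => x.
by rewrite mem_enum; exact: At.
Qed.

(** An edge above [B] has exactly one further point, so counting edges becomes counting points
    outside [B]. *)
Lemma card_edges_above (T : finType) k (E : {set {set T}}) (B : {set T}) :
    uniform_hypergraph k E -> k = #|B|.+1 ->
  #|[set e in E | B \subset e]| = #|[set l in ~: B | l |: B \in E]|.
Proof.
move=> uE kB.
have injU :
    {in [set l in ~: B | l |: B \in E] &, injective (fun l => l |: B)}.
  move=> l m; rewrite !inE => /andP[lB _] /andP[mB _] /= /setP/(_ l).
  by rewrite !inE eqxx (negbTE lB) !orbF => /esym/eqP.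
rewrite -(card_in_imset injU); apply: eq_card => e.
rewrite !inE; apply/andP/imsetP=> [[eE Be] | [l]]; last first.
  by rewrite !inE /= => /andP[_ lE] ->; rewrite lE subsetUr.
have /cards1P[l eBl] : #|e :\: B| == 1.
  by rewrite cardsD (setIidPr Be) (uE e eE) kB subSn // subnn.
have [le lB] : l \in e /\ l \notin B.
  by have := set11 l; rewrite -eBl inE => /andP[].
have De : e = l |: B.
  rewrite -eBl; apply/setP=> x; rewrite !inE.
  by case: (boolP (x \in B)) => [/(subsetP Be) ->|_]; rewrite ?orbT ?orbF.
by exists l; rewrite ?inE ?lB -?De.
Qed.

(** Rows [j] and [k] are orthogonal; the terms at [j] and [k] vanish with the diagonal, leaving the
    term at [i] to move across. *)
Lemma conference_sum_outside (R : numDomainType) m (S : 'M[R]_m) i j k :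
    symmetric_conference_matrix S -> uniq [:: i; j; k] ->
  \sum_(l | l \notin [:: i; j; k]) S j l * S k l = - (S i j * S i k).
Proof.
case=> sym diag0 _ SS Uijk.
have njk : j != k by case/and3P: Uijk => _; rewrite inE.
have /matrixP/(_ j k) := SS.
rewrite !mxE (negbTE njk) mulr0n (bigID (mem [:: i; j; k])) /=.
rewrite -big_uniq //= !big_cons big_nil !mxE
  !diag0 mulr0 mul0r !addr0.
have symE a b : S a b = S b a by rewrite -{1}sym mxE.
rewrite (symE j i) (symE k i) addrC => /eqP; rewrite addr_eq0 => /eqP <-.
by apply: eq_bigr => l _; rewrite mxE.
Qed.

(** The three squares are 1. Each cross product is grouped as a factor independent of [l] times two
    entries of column [l], the shape needed for summation over [l]. *)
Lemma conference_det4 (R : numDomainType) m (S : 'M[R]_m) i j k l :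
    symmetric_conference_matrix S -> uniq [:: i; j; k; l] ->
  \det (principal_submx S (l |: [set x in [:: i; j; k]])) =
    3 - (S i j * S i k * (S j l * S k l) + S i j * S j k * (S i l * S k l)
         + S i k * S j k * (S i l * S j l)) *+ 2.
Proof.
case=> sym diag0 pm1 _ U.
have symE a b : S a b = S b a by rewrite -{1}sym mxE.
have sq1 a b : a != b -> S a b ^+ 2 = 1.
  by move=> /pm1[] ->; rewrite ?sqrrN expr1n.
rewrite (det_principal_submx S (t := [tuple i; j; k; l])) //; last first.
  by move=> x; rewrite !inE orbC -!orbA.
pose f a b := S (nth i [:: i; j; k; l] a) (nth i [:: i; j; k; l] b).
have -> : mxsub (tnth [tuple i; j; k; l]) (tnth [tuple i; j; k; l]) S =
          \matrix_(a < 4, b < 4) f a b.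
  by apply/matrixP=> a b; rewrite !mxE !(tnth_nth i).
rewrite det_symmetric_mx44 /f /=; [|by move=> *; exact: symE|by []].
move: U; rewrite /= !inE !negb_or -!andbA.
case/and5P=> ij ik il jk /and3P[jl kl _].
rewrite !exprMn !sq1 // !mulr1.
by ring.
Qed.

(** The three cross products are signs with product 1, so they are all 1 or exactly two of them are
    -1; the proof simply checks the 64 sign patterns. *)
Lemma conference_det4_cases (R : numDomainType) m (S : 'M[R]_m) i j k l :
    symmetric_conference_matrix S -> uniq [:: i; j; k; l] ->
  let d := \det (principal_submx S (l |: [set x in [:: i; j; k]])) in
  d = 5 \/ d = -3.
Proof.
move=> confS U; rewrite /= conference_det4 //.
case: confS => _ _ pm1 _.
move: U; rewrite /= !inE !negb_or -!andbA.
case/and5P=> ij ik il jk /and3P[jl kl _].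
case: (pm1 _ _ ij) (pm1 _ _ ik) (pm1 _ _ il) (pm1 _ _ jk) (pm1 _ _ jl)
  (pm1 _ _ kl) => -> [] -> [] -> [] -> [] -> [] ->;
  by [left; ring | right; ring].
Qed.

Lemma card_outside_triple (T : finType) (i j k : T) :
  uniq [:: i; j; k] -> (3 + #|[pred l | l \notin [:: i; j; k]]|)%N = #|T|.
Proof. by move=> U; rewrite -(cardC (mem [:: i; j; k])) (card_uniqP U). Qed.

(** Each cross product sums to minus a square of signs, that is -1, so the total is
    [3 (m - 3) + 6]. *)
Lemma conference_det4_sum (R : numDomainType) m (S : 'M[R]_m) i j k :
    symmetric_conference_matrix S -> uniq [:: i; j; k] ->
  \sum_(l | l \notin [:: i; j; k])
     \det (principal_submx S (l |: [set x in [:: i; j; k]])) =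
  (3 * m)%:R - 3.
Proof.
move=> confS U.
under eq_bigr => l lN.
  rewrite conference_det4 //; last first.
    by rewrite -[[:: i; j; k; l]]/(rcons [:: i; j; k] l) rcons_uniq lN.
  over.
have [sym diag0 pm1 _] := confS.
have symE a b : S a b = S b a by rewrite -{1}sym mxE.
have sq1 a b : a != b -> S a b ^+ 2 = 1.
  by move=> /pm1[] ->; rewrite ?sqrrN expr1n.
(* Each point of the triple in turn takes the role of [i], while the index set of the sum stays
   fixed. *)
have outside a b c : perm_eq [:: a; b; c] [:: i; j; k] ->
    \sum_(l | l \notin [:: i; j; k]) S b l * S c l = - (S a b * S a c).
  move=> p; rewrite -conference_sum_outside ?(perm_uniq p) //.
  by apply: eq_bigl => l; rewrite (perm_mem p).
rewrite big_split /= sumr_const sumrN sumrMnl !big_split /= -!mulr_sumr.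
rewrite (outside i j k) // (outside j i k); last by apply/seq.permP=> p /=; lia.
rewrite (outside k i j); last by apply/seq.permP=> p /=; lia.
rewrite -[in RHS](card_ord m) -(card_outside_triple U).
rewrite (symE j i) (symE k i) (symE k j) !mulrN -!expr2 !exprMn.
move: U; rewrite /= !inE negb_or andbT => /andP[/andP[ij ik] jk]; rewrite !sq1 //.
rewrite mulnDr natrD natrM -(mulr_natr 3 #|_|).
by ring.
Qed.

Theorem mainTheorem3 (R : numDomainType) (n : nat) (S : 'M[R]_(4 * n + 2)) :
  (6 <= 4 * n + 2)%N ->
  symmetric_conference_matrix S ->
  is_design 3 (4 * n + 2) 4 (3 * n) (det_hypergraph S 4 5) /\
  is_design 3 (4 * n + 2) 4 (n - 1) (det_hypergraph S 4 (-3)).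
Proof.
move=> n_ge1 confS.
have unif a : uniform_hypergraph 4 (det_hypergraph S 4 a).
  by move=> e; rewrite inE => /andP[/eqP].
suff count (B : {set 'I_(4 * n + 2)}) : #|B| = 3 ->
    #|[set e in det_hypergraph S 4 5 | B \subset e]| = (3 * n)%N /\
    #|[set e in det_hypergraph S 4 (-3) | B \subset e]| = (n - 1)%N.
  by split; split; rewrite ?card_ord // => B /count[].
move=> cB; rewrite !(card_edges_above (unif _)) ?cB //.
move: cB; case: cards_eqP => -[|i [|j [|k []]]] // U _.
pose d l := \det (principal_submx S (l |: [set x in [:: i; j; k]])).
pose N a := #|[set l | (l \notin [:: i; j; k]) && (d l == a)]|.
have edgesN a : #|[set l in ~: [set x in [:: i; j; k]] |
    l |: [set x in [:: i; j; k]] \in det_hypergraph S 4 a]| = N a.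
  apply: eq_card => l; rewrite 2!in_set in_setC !in_set -/(d l).
  by case lB: (l \in [:: i; j; k]); rewrite //= cardsU1 in_set lB
    cardsE (card_uniqP U).
rewrite !edgesN.
have two_values l : l \notin [:: i; j; k] -> d l = 5 \/ d l = -3.
  move=> lN; apply: conference_det4_cases => //.
  by rewrite -[[:: i; j; k; l]]/(rcons [:: i; j; k] l) rcons_uniq lN.
(* The difference is 8, nonzero in characteristic 0. *)
have neq : 5 != -3 :> R by rewrite -subr_eq0 opprK -natrD pnatr_eq0.
have not5 l : (l \notin [:: i; j; k]) && (d l != 5) =
    (l \notin [:: i; j; k]) && (d l == -3).
  case: (boolP (l \notin _)) => //= /two_values[] ->.
    by rewrite eqxx (negbTE neq).
  by rewrite eqxx eq_sym neq.
(* Used twice: the constant 1 counts the fourth points, the identity sums the minors. *)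
have sumN (F : R -> R) : \sum_(l | l \notin [:: i; j; k]) F (d l) =
    F 5 *+ N 5 + F (-3) *+ N (-3).
  rewrite (bigID (fun l => d l == 5)) /= (eq_bigl _ _ not5).
  rewrite /N !cardsE -!sumr_const.
  by congr (_ + _); apply: eq_bigr => l /andP[_ /eqP ->].
have cardN : (3 + (N 5%R + N (-3)%R) = 4 * n + 2)%N.
  apply/eqP; rewrite -[eqbRHS]card_ord -(card_outside_triple U) eqn_add2l.
  by rewrite -(eqr_nat R) natrD -(sumN (fun=> 1)) sumr_const.
(* Negative terms are moved across so that the equation can be stated in [nat]. *)
have sum_d : (5 * N 5%R + 3 = 3 * (4 * n + 2) + 3 * N (-3)%R)%N.
  apply/eqP; rewrite -(eqr_nat R); apply/eqP.
  have := conference_det4_sum confS U; rewrite (sumN id) => E.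
  have {E} /eqP := E; rewrite eq_sym subr_eq => /eqP E.
  rewrite [in RHS]natrD E natrD !natrM -(mulr_natr 5) -(mulr_natr (-3)); ring.
(* From [p + q = 4 n - 1] and [5 p - 3 q = 12 n + 3] follows [8 p = 24 n]. Since [n >= 1], the
   truncated [n - 1] is the true difference. *)
move: cardN sum_d n_ge1; move: (N 5) (N (-3)) => p q; lia.
Qed.
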